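(* For every $n\ge1$, the restriction of $\pi_\downarrow^{3412}$ is a bijection from the Baxter permutations in $S_n$ to the twisted Baxter permutations in $S_n$. Its inverse is the restriction of $\pi^\uparrow_{3412}$ (to twisted Baxter permutations).
   Context: Permutations are in one-line notation $x=x_1\cdots x_n\in S_n$. Patterns, always with $a<b<c<d$: $x$ contains 3-41-2 if it has a subsequence $c\,d\,a\,b$ with $d$ immediately before $a$ in $x$; 2-41-3 if it has a subsequence $b\,d\,a\,c$ with $d$ immediately before $a$; 3-14-2 if it has a subsequence $c\,a\,d\,b$ with $a$ immediately before $d$. A Baxter permutation is one avoiding both 3-14-2 and 2-41-3; a twisted Baxter permutation is one avoiding both 3-41-2 and 2-41-3. The weak order on $S_n$ is the partial order in which one moves up by a cover by swapping adjacent entries $x_i<x_{i+1}$; it is a lattice. A permutation $x$ is obtained from $y$ by a $(3412\to3142)$-move if $y$ has a subsequence $c\,d\,a\,b$ as in the pattern 3-41-2 and $x$ is $y$ with the adjacent entries $d,a$ swapped. $\Theta_{3412}$ is the lattice congruence on the weak order on $S_n$ such that, for a cover $x\lessdot y$, $x\equiv y$ if and only if $x$ is obtained from $y$ by a $(3412\to3142)$-move; its classes are intervals, so it is the equivalence relation generated by these moves (that it is a lattice congruence is known). $\pi_\downarrow^{3412}$ sends a permutation to the minimal element of its $\Theta_{3412}$-class, and $\pi^\uparrow_{3412}$ sends it to the maximal element of its class. *)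

(* Defs.v *)
From mathcomp Require Import all_boot all_fingroup.

Set Implicit Arguments.
Unset Strict Implicit.
Unset Printing Implicit Defensive.

(* A permutation [x : 'S_n] is read in one-line notation as x(0) x(1) ... x(n-1),
   with positions and values counted from 0.  [tperm q r * x] (product of
   permutations composed from left to right) exchanges the entries of [x] at the
   positions [q] and [r]. *)

Section Baxter.

Variable n : nat.
Implicit Types (x y z m : 'S_n) (p q r s : 'I_n).

(* The pattern shape "-- ** --" shared by all the patterns below: four
   increasing positions, the two middle ones being consecutive. *)
Definition vincular_pos p q r s : bool :=
  [&& p < q, r == q.+1 :> nat & r < s].

(* In each case the entries at p, q, r, s are, for some a < b < c < d:
   c, d, a, b for 3-41-2;  b, d, a, c for 2-41-3;  c, a, d, b for 3-14-2. *)
Definition occ_3412 x p q r s : bool :=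
  vincular_pos p q r s && [&& x r < x s, x s < x p & x p < x q].

Definition occ_2413 x p q r s : bool :=
  vincular_pos p q r s && [&& x r < x p, x p < x s & x s < x q].

Definition occ_3142 x p q r s : bool :=
  vincular_pos p q r s && [&& x q < x s, x s < x p & x p < x r].

Definition contains_3412 x : bool :=
  [exists p, exists q, exists r, exists s, occ_3412 x p q r s].

Definition contains_2413 x : bool :=
  [exists p, exists q, exists r, exists s, occ_2413 x p q r s].

Definition contains_3142 x : bool :=
  [exists p, exists q, exists r, exists s, occ_3142 x p q r s].

Definition Baxter : {set 'S_n} :=
  [set x | ~~ contains_3142 x & ~~ contains_2413 x].

Definition twisted_Baxter : {set 'S_n} :=
  [set x | ~~ contains_3412 x & ~~ contains_2413 x].

Definition weak_cover x y : bool :=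
  [exists q : 'I_n, exists r : 'I_n,
    [&& r == q.+1 :> nat, x q < x r & y == (tperm q r * x)%g]].

Definition weak_le : rel 'S_n := connect weak_cover.

Definition move_3412_3142 y x : bool :=
  [exists p, exists q, exists r, exists s,
    occ_3412 y p q r s && (x == (tperm q r * y)%g)].

(* [connect] is the reflexive transitive closure; applied to a symmetric
   relation it yields the equivalence relation generated by the moves. *)
Definition Theta_3412 : rel 'S_n :=
  connect (fun x y => move_3412_3142 x y || move_3412_3142 y x).

(* The classes of Theta_3412 are intervals of the weak order, so the default
   value of [odflt] is never used. *)
Definition pi_down_3412 x : 'S_n :=
  odflt x [pick m | Theta_3412 x m &
                    [forall z, Theta_3412 x z ==> weak_le m z]].

Definition pi_up_3412 x : 'S_n :=
  odflt x [pick m | Theta_3412 x m &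
                    [forall z, Theta_3412 x z ==> weak_le z m]].

End Baxter.

(* Main.v *)
(** Whether two adjacent entries may be swapped by a move, up or down, depends
    only on the two entries and on the sets of entries to their left and to
    their right.  Hence the moves are locally confluent in each direction, and
    Newman's lemma gives every class a unique 3-41-2-avoider, its minimum, and a
    unique 3-14-2-avoider, its maximum.  It remains to see that the minimum
    avoids 2-41-3 exactly when the maximum does.  For this one uses pairs a < d
    such that d precedes a, all the values in between lie left of d or right of
    a, and both sides occur, the values on the left being the smaller ones.
    Having such a pair is invariant under moves, it implies 2-41-3, and it
    follows from 2-41-3 if 3-41-2 or 3-14-2 is avoided. *)

Require Import Defs.
From mathcomp Require Import all_boot all_fingroup.
From mathcomp Require Import zify.

Set Implicit Arguments.
Unset Strict Implicit.
Unset Printing Implicit Defensive.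

(** * Newman's lemma and normal forms *)

Section Newman.

Variables (T : finType) (e : rel T) (f : T -> nat).
Hypothesis f_dec : forall x y, e x y -> f y < f x.
Hypothesis local_confluence : forall x y z, e x y -> e x z ->
  exists2 w, connect e y w & connect e z w.

Lemma connect_first x y : connect e x y ->
  x = y \/ exists2 z, e x z & connect e z y.
Proof.
move=> /connectP[[|z p] /= xp ->]; first by left.
move/andP: xp => [xz zp]; right; exists z => //.
by apply/connectP; exists p.
Qed.

(** Induction on [f x]: local confluence joins the two first steps, and the induction hypothesis at
    [y1] and then at [z1] joins the rest. *)
Lemma newman_confluence x y z : connect e x y -> connect e x z ->
  exists2 w, connect e y w & connect e z w.
Proof.
have [k] := ubnP (f x); elim: k => // k IH in x y z * => xk.
move=> xy xz; case: (connect_first xy) => [<-|[y1 xy1 y1y]]; first by exists z.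
case: (connect_first xz) => [<-|[z1 xz1 z1z]]; first by exists y.
have [w y1w z1w] := local_confluence xy1 xz1.
have lt_k u : e x u -> f u < k by move=> /f_dec fu; apply: leq_trans fu xk.
have [w1 yw1 ww1] := IH _ _ _ (lt_k _ xy1) y1y y1w.
have [w2 zw2 w1w2] := IH _ _ _ (lt_k _ xz1) z1z (connect_trans z1w ww1).
by exists w2 => //; apply: connect_trans yw1 w1w2.
Qed.

Lemma normal_form x : exists2 y, connect e x y & forall z, ~~ e y z.
Proof.
have [k] := ubnP (f x); elim: k => // k IH in x * => xk.
have [/existsP[y xy]|/existsPn xn] := boolP [exists y, e x y]; last first.
  by exists x.
have [|z yz zn] := IH y; first exact: leq_trans (f_dec xy) xk.
by exists z => //; apply: connect_trans yz; apply: connect1.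
Qed.

(** Induction along the zigzag: a step against [e] is absorbed by confluence at its source [z]. *)
Lemma church_rosser x y : connect (fun u v => e u v || e v u) x y ->
  exists2 w, connect e x w & connect e y w.
Proof.
move=> /connectP[p + ->]; elim: p x => [|z p IH] x /=; first by exists x.
move=> /andP[xz /IH[w zw lw]].
case/orP: xz => [xz|zx].
  by exists w => //; apply: connect_trans zw; apply: connect1.
have [w' xw' ww'] := newman_confluence (connect1 zx) zw.
by exists w' => //; apply: connect_trans lw ww'.
Qed.

Lemma connect_normal x y : (forall z, ~~ e x z) -> connect e x y -> y = x.
Proof. by move=> xn /connect_first[//|[z]]; rewrite (negPf (xn z)). Qed.

Lemma normal_form_class x y : (forall z, ~~ e y z) ->
  connect (fun u v => e u v || e v u) x y -> connect e x y.
Proof. by move=> yn /church_rosser[w xw /(connect_normal yn) <-]. Qed.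

End Newman.

(** * Moves as swaps of adjacent entries *)

Section Moves.

Variable n : nat.
Implicit Types (x y z m : 'S_n) (p q r s i j k a b c d u v w : 'I_n) (up : bool).

Lemma val_neq (i j : 'I_n) : i != j -> (i : nat) <> j.
Proof. by move=> /eqP ij /val_inj. Qed.

(** A discrete intermediate value argument. Applied to positions it yields the adjacent middle
    entries of a pattern, applied to values a pair of consecutive values. *)
Lemma last_in_prefix (P : pred 'I_n) i j : i < j -> P i -> ~~ P j ->
  exists q r, [/\ r = q.+1 :> nat, i <= q, r <= j, P q & ~~ P r].
Proof.
move=> ij Pi Pj.
have [k Dk] : exists k : nat, j = i + k :> nat by exists (j - i); lia.
elim: k i ij Pi Dk => [|k IH] i ij Pi Dk; first by lia.
have i1n : i.+1 < n by have := ltn_ord j; lia.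
have [P1|P1] := boolP (P (Ordinal i1n)); last first.
  by exists i, (Ordinal i1n); split=> //=; lia.
have i1j : Ordinal i1n < j.
  rewrite ltn_neqAle ij andbT; apply: contraNneq Pj => i1j.
  by rewrite -(_ : Ordinal i1n = j) //; apply: val_inj.
have [|q [r [rq iq rj Pq Pr]]] := IH (Ordinal i1n) i1j P1; first by rewrite /=; lia.
by exists q, r; split=> //=; rewrite /= in iq; lia.
Qed.

(** The minimum and maximum make the condition blind to the order of the two entries, so that one
    predicate serves both 3-41-2 and 3-14-2 and survives the swap itself. *)
Definition swappable x q r : bool :=
  (r == q.+1 :> nat) &&
  [exists p : 'I_n, exists s : 'I_n,
     [&& p < q, r < s, minn (x q) (x r) < x s, x s < x p &
         x p < maxn (x q) (x r)]].

Lemma swappableP x q r :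
  reflect (r = q.+1 :> nat /\
    exists p s : 'I_n, [/\ p < q, r < s, minn (x q) (x r) < x s, x s < x p &
                           x p < maxn (x q) (x r)])
          (swappable x q r).
Proof.
apply: (iffP andP) => [[/eqP-> /existsP[p /existsP[s /and5P[*]]]]|].
  by split=> //; exists p, s.
move=> [-> [p [s [*]]]]; split=> //.
by apply/existsP; exists p; apply/existsP; exists s; apply/and5P.
Qed.

(** With [up] true the step goes up in the weak order, from 3-14-2 to 3-41-2. The flag lets
    termination and confluence be proved once for both directions. *)
Definition swap_step up : rel 'S_n := fun x y =>
  [exists q, exists r, [&& swappable x q r, (x q < x r) == up &
                           y == (tperm q r * x)%g]].

Lemma swap_stepP up x y :
  reflect (exists q r, [/\ swappable x q r, (x q < x r) = up &
                           y = (tperm q r * x)%g])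
          (swap_step up x y).
Proof.
apply: (iffP existsP) => [[q /existsP[r /and3P[? /eqP ? /eqP ?]]]|].
  by exists q, r.
move=> [q [r [sw xqr ->]]]; exists q; apply/existsP; exists r.
by rewrite sw xqr !eqxx.
Qed.

Lemma swap_out x q r p : p != q -> p != r -> (tperm q r * x)%g p = x p.
Proof. by move=> pq pr; rewrite permM tpermD // eq_sym. Qed.

Lemma swap_l x q r : (tperm q r * x)%g q = x r.
Proof. by rewrite permM tpermL. Qed.

Lemma swap_r x q r : (tperm q r * x)%g r = x q.
Proof. by rewrite permM tpermR. Qed.

Lemma swap_lt x q r p : r = q.+1 :> nat -> p < q -> (tperm q r * x)%g p = x p.
Proof. by move=> rq pq; rewrite swap_out // -val_eqE /=; lia. Qed.

Lemma swap_gt x q r p : r = q.+1 :> nat -> r < p -> (tperm q r * x)%g p = x p.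
Proof. by move=> rq pq; rewrite swap_out // -val_eqE /=; lia. Qed.

Lemma swappable_swap x q r : swappable x q r -> swappable (tperm q r * x)%g q r.
Proof.
move=> /swappableP[rq [p [s [pq rs ? ? ?]]]]; apply/swappableP; split=> //.
by exists p, s; rewrite swap_l swap_r (swap_lt _ rq pq) (swap_gt _ rq rs) minnC maxnC.
Qed.

Lemma swap_step_sym x y : swap_step true x y = swap_step false y x.
Proof.
apply/idP/idP => /swap_stepP[q [r [sw xqr ->]]]; apply/swap_stepP; exists q, r;
  rewrite swappable_swap // swap_l swap_r mulgA tperm2 mul1g.
  by split=> //; apply: negbTE; rewrite -leqNgt ltnW.
split=> //; rewrite ltn_neqAle leqNgt xqr andbT.
rewrite val_eqE (inj_eq perm_inj) -val_eqE /=.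
by move/swappableP: sw => [-> _]; lia.
Qed.

Lemma move_swap_step x y : move_3412_3142 x y = swap_step false x y.
Proof.
apply/existsP/swap_stepP => [[p /existsP[q /existsP[r /existsP[s]]]]|].
  move=> /andP[/andP[/and3P[pq /eqP rq rs] /and3P[ab bc cd]] /eqP ->].
  exists q, r; split=> //; last by lia.
  by apply/swappableP; split=> //; exists p, s; split=> //; lia.
move=> [q [r [/swappableP[rq [p [s [? ? ? ? ?]]]] ? ->]]].
exists p; apply/existsP; exists q; apply/existsP; exists r; apply/existsP; exists s.
by rewrite eqxx andbT /occ_3412 /vincular_pos; lia.
Qed.

Lemma ThetaE up x y : Theta_3412 x y =
  connect (fun y z => swap_step up y z || swap_step up z y) x y.
Proof.
apply: eq_connect => u v; rewrite !move_swap_step.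
by case: up; rewrite // !swap_step_sym orbC.
Qed.

Lemma Theta_sym x y : Theta_3412 x y = Theta_3412 y x.
Proof. by rewrite /Theta_3412; apply: sym_connect_sym => u v; rewrite orbC. Qed.

(** * Termination, and antisymmetry of the weak order *)

(** Exchanging an adjacent ascent lowers the sum of position times value by the difference of the
    two entries; complementing the values gives the same for descents. *)
Definition weight up x : nat := \sum_(i < n) i * (if up then x i : nat else n - x i).

Lemma weight_swap up x q r : r = q.+1 :> nat -> (x q < x r) = up ->
  weight up (tperm q r * x)%g < weight up x.
Proof.
move=> rq xqr.
have qr : r != q by rewrite -val_eqE /=; lia.
have xneq : (x q : nat) <> x r by apply: val_neq; rewrite (inj_eq perm_inj) eq_sym.
rewrite /weight (bigD1 q) // (bigD1 r) //= [ltnRHS](bigD1 q) // [in ltnRHS](bigD1 r) //=.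
rewrite swap_l swap_r rq.
under eq_bigr => i /andP[iq ir] do rewrite swap_out //.
have := ltn_ord (x q); have := ltn_ord (x r).
rewrite !mulSn.
case: up xqr => /= xqr; move: (\sum_(i < n | _) _) => S.
  by lia.
move=> xr_lt xq_lt.
have : n - x q < n - x r by lia.
by move: (n - x q) (n - x r) => A B; lia.
Qed.

Lemma weight_step up x y : swap_step up x y -> weight up y < weight up x.
Proof.
by move=> /swap_stepP[q [r [/andP[/eqP rq _] xqr ->]]]; apply: weight_swap.
Qed.

Lemma weak_cover_weight x y : weak_cover x y -> weight true y < weight true x.
Proof.
by move=> /existsP[q /existsP[r /and3P[/eqP rq xqr /eqP ->]]]; apply: weight_swap.
Qed.

Lemma weak_le_anti x y : weak_le x y -> weak_le y x -> x = y.
Proof.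
have le_w (u v : 'S_n) : weak_le u v -> weight true v <= weight true u.
  move=> /connectP[p + ->]; elim: p u => //= w p IH u /andP[/weak_cover_weight uw].
  by move=> /IH; lia.
move=> /connect_first[//|[z /weak_cover_weight xz /le_w zy]] /le_w.
by lia.
Qed.

Lemma swap_step_cover x y : swap_step true x y -> weak_cover x y.
Proof.
move=> /swap_stepP[q [r [/andP[rq _] xqr ->]]].
by apply/existsP; exists q; apply/existsP; exists r; rewrite rq xqr /=.
Qed.

(** * Local confluence *)

Lemma braid x i j k : i != j -> j != k -> i != k ->
  (tperm i j * (tperm j k * (tperm i j * x)) =
   tperm j k * (tperm i j * (tperm j k * x)))%g.
Proof.
move=> ij jk ik; rewrite !mulgA; congr (_ * x)%g.
have := tpermJ i j (tperm j k); have := tpermJ j k (tperm i j).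
rewrite tpermL tpermR !tpermD // 1?eq_sym // /conjg !tpermV.
by rewrite !mulgA => -> ->.
Qed.

(** The three entries are monotone, and the two sides of the braid relation both reverse them. The
    witnesses of either adjacent pair also serve for the outer pair, whose values span a larger
    interval, once they are known to lie outside the three positions. *)
Lemma swap_step_triple up x i j k : j = i.+1 :> nat -> k = j.+1 :> nat ->
  swappable x i j -> swappable x j k ->
  (x i < x j) = up -> (x j < x k) = up ->
  exists2 w, connect (swap_step up) (tperm i j * x)%g w &
             connect (swap_step up) (tperm j k * x)%g w.
Proof.
move=> ji kj /swappableP[_ [p [s [pi js bs sp cp]]]].
move=> /swappableP[_ [p' [s' [pj' ks' bs' sp' cp']]]] xij xjk.
have ij : i != j by rewrite -val_eqE /=; lia.
have jk : j != k by rewrite -val_eqE /=; lia.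
have ik : i != k by rewrite -val_eqE /=; lia.
(* The value at [s] lies strictly between those at [i] and [j], while by monotonicity the value at
   [k] does not; symmetrically for [p'] and [i]. *)
have sk : k < s.
  have : (s : nat) <> k by move=> /val_inj Es; rewrite Es in bs sp; lia.
  by lia.
have pi' : p' < i.
  have : (p' : nat) <> i by move=> /val_inj Ep; rewrite Ep in sp' cp'; lia.
  by lia.
have [bs1 cp1] : minn (x i) (x k) < x s /\ x p < maxn (x i) (x k) by lia.
have [bs2 cp2] : minn (x i) (x k) < x s' /\ x p' < maxn (x i) (x k) by lia.
have xik : (x i < x k) = up by lia.
have [js' pj] : j < s' /\ p < j by lia.
have ltE (t : 'I_n) : t < i -> [/\ t != i, t != j & t != k].
  by move=> tk; split; rewrite -val_eqE /=; lia.
have gtE (t : 'I_n) : k < t -> [/\ t != i, t != j & t != k].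
  by move=> tk; split; rewrite -val_eqE /=; lia.
have step (y : 'S_n) u v (t t' : 'I_n) : v = u.+1 :> nat -> t < u -> v < t' ->
    [/\ minn (y u) (y v) < y t', y t' < y t & y t < maxn (y u) (y v)] ->
    (y u < y v) = up -> connect (swap_step up) y (tperm u v * y)%g.
  move=> vu tu vt' [? ? ?] yuv; apply/connect1/swap_stepP; exists u, v; split=> //.
  by apply/swappableP; split=> //; exists t, t'.
have [? ? ?] := ltE _ pi; have [? ? ?] := ltE _ pi'.
have [? ? ?] := gtE _ sk; have [? ? ?] := gtE _ ks'.
have [ji' kj' ki'] : [/\ j != i, k != j & k != i] by rewrite !(eq_sym _ i) (eq_sym k).
have Eij (y : 'S_n) (t := (tperm i j * y)%g) :
    ((t i = y j) * (t j = y i) * (t k = y k) * (t p = y p) * (t s = y s) *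
     (t p' = y p') * (t s' = y s'))%type.
  by rewrite /t swap_l swap_r !(@swap_out y i j).
have Ejk (y : 'S_n) (t := (tperm j k * y)%g) :
    ((t i = y i) * (t j = y k) * (t k = y j) * (t p = y p) * (t s = y s) *
     (t p' = y p') * (t s' = y s'))%type.
  by rewrite /t swap_l swap_r !(@swap_out y j k).
pose E := (Eij, Ejk).
exists (tperm i j * (tperm j k * (tperm i j * x)))%g.
  apply: (@connect_trans _ _ (tperm j k * (tperm i j * x))%g).
    by apply: (step _ j k p s); rewrite ?E.
  by apply: (step _ i j p' s'); rewrite ?E.
rewrite braid //.
apply: (@connect_trans _ _ (tperm i j * (tperm j k * x))%g).
  by apply: (step _ i j p' s'); rewrite ?E.
by apply: (step _ j k p s); rewrite ?E.
Qed.

Lemma tperm_ltn q r p k : r = q.+1 :> nat -> r < k \/ k <= q ->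
  (tperm q r p < k) = (p < k).
Proof. by move=> rq; case: tpermP => [->|->|_ _] //; lia. Qed.

Lemma tperm_gtn q r p (k : nat) : r = q.+1 :> nat -> r <= k \/ k < q ->
  (k < tperm q r p) = (k < p).
Proof. by move=> rq; case: tpermP => [->|->|_ _] //; lia. Qed.

Lemma swappable_far x q r q' r' : r = q.+1 :> nat -> r < q' \/ r' < q ->
  swappable x q' r' -> swappable (tperm q r * x)%g q' r'.
Proof.
move=> rq far /swappableP[rq' [p [s [pq rs ? ? ?]]]].
(* A witness may sit at [q] or [r]; it then moves along with its entry, without crossing [q'] or
   [r']. *)
apply/swappableP; split=> //; exists (tperm q r p), (tperm q r s).
have [? ? ? ?] : [/\ q' != q, q' != r, r' != q & r' != r].
  by split; rewrite -val_eqE /=; lia.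
by rewrite tperm_ltn ?tperm_gtn // ?(permM, tpermK) ?tpermD 1?eq_sym //; lia.
Qed.

Lemma swap_step_far up x q r q' r' : r < q' ->
  swappable x q r -> (x q < x r) = up ->
  swappable x q' r' -> (x q' < x r') = up ->
  exists2 w, connect (swap_step up) (tperm q r * x)%g w &
             connect (swap_step up) (tperm q' r' * x)%g w.
Proof.
move=> rq' sw xqr sw' xqr'.
have /swappableP[rq _] := sw; have /swappableP[rq'' _] := sw'.
have [? ? ? ?] : [/\ q' != q, q' != r, r' != q & r' != r].
  by split; rewrite -val_eqE /=; lia.
exists (tperm q' r' * (tperm q r * x))%g; apply/connect1/swap_stepP.
  exists q', r'; split=> //; last by rewrite !swap_out.
  by apply: swappable_far => //; left.
exists q, r; split=> //.
- by apply: swappable_far => //; right.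
- by rewrite !swap_out // eq_sym.
rewrite !mulgA; congr (_ * x)%g.
by rewrite [RHS]conjgC tpermJ !tpermD.
Qed.

Lemma swap_step_confluence up x y z : swap_step up x y -> swap_step up x z ->
  exists2 w, connect (swap_step up) y w & connect (swap_step up) z w.
Proof.
move=> /swap_stepP[q [r [sw xqr ->]]] /swap_stepP[q' [r' [sw' xqr' ->]]].
wlog le_qq' : q r q' r' sw xqr sw' xqr' / q <= q'.
  move=> W; have [|/ltnW le] := leqP q q'; first exact: W.
  by have [w] := W _ _ _ _ sw' xqr' sw xqr le; exists w.
have /swappableP[rq _] := sw; have /swappableP[rq' _] := sw'.
have [/val_inj Dq|/eqP neq] := @eqP _ (q : nat) q'.
  have Dr : r = r' by apply: val_inj; rewrite /= rq rq' Dq.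
  by subst q' r'; exists (tperm q r * x)%g.
have [lt|le] := ltnP r q'; first exact: swap_step_far.
have Dr : r = q' by apply: val_inj => /=; lia.
by subst q'; apply: swap_step_triple.
Qed.

(** * Normal forms as the extremal elements of the classes *)

Lemma contains_step_down x :
  contains_3412 x = [exists y, swap_step false x y].
Proof.
apply/existsP/existsP => [[p /existsP[q /existsP[r /existsP[s occ]]]]|].
  exists (tperm q r * x)%g; rewrite -move_swap_step.
  apply/existsP; exists p; apply/existsP; exists q.
  by apply/existsP; exists r; apply/existsP; exists s; rewrite occ eqxx.
move=> [y]; rewrite -move_swap_step => /existsP[p /existsP[q /existsP[r /existsP[s]]]].
move=> /andP[occ _]; exists p; apply/existsP; exists q.
by apply/existsP; exists r; apply/existsP; exists s.
Qed.

Lemma contains_step_up x :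
  contains_3142 x = [exists y, swap_step true x y].
Proof.
apply/existsP/existsP => [[p /existsP[q /existsP[r /existsP[s]]]]|].
  move=> /andP[/and3P[? /eqP ? ?] /and3P[? ? ?]].
  exists (tperm q r * x)%g; apply/swap_stepP; exists q, r; split=> //; last by lia.
  by apply/swappableP; split=> //; exists p, s; split=> //; lia.
case=> y /swap_stepP[q [r [/swappableP[rq [p [s [? ? ? ? ?]]]] ? _]]].
exists p; apply/existsP; exists q; apply/existsP; exists r; apply/existsP; exists s.
by rewrite /occ_3142 /vincular_pos; lia.
Qed.

Lemma swap_connect_weak (up : bool) x y : connect (swap_step up) x y ->
  if up then weak_le x y else weak_le y x.
Proof.
move=> /connectP[p + ->]; elim: p x => [|z p IH] x /=.
  by case: up => _; apply: connect0.
move=> /andP[xz /IH]; case: up xz {IH}.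
  by move=> /swap_step_cover/connect1; apply: connect_trans.
rewrite -swap_step_sym => /swap_step_cover/connect1 zx.
by move=> /connect_trans; apply.
Qed.

(** Turns equivalence into one-way reachability, hence into comparability in the weak order with the
    normal form. *)
Lemma normal_Theta up x m : ~~ [exists y, swap_step up m y] ->
  Theta_3412 x m -> connect (swap_step up) x m.
Proof.
move=> /existsPn mn; rewrite (ThetaE up).
exact: (normal_form_class (@weight_step up) (@swap_step_confluence up)).
Qed.

(** All members of the class descend to [m], so [m] qualifies for the [pick], which excludes the
    default value; antisymmetry identifies it with the element picked. *)
Lemma pi_downE x m : ~~ contains_3412 m -> Theta_3412 x m -> pi_down_3412 x = m.
Proof.
rewrite contains_step_down => mn xm.
have m_min z : Theta_3412 x z -> weak_le m z.
  move=> xz; apply: (@swap_connect_weak false); apply: normal_Theta => //.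
  by apply: connect_trans xm; rewrite -/(Theta_3412 _ _) Theta_sym.
rewrite /pi_down_3412; case: pickP => [m' /andP[xm' /forallP m'_min]|/(_ m)/negP[]].
  by apply: weak_le_anti (m_min _ xm'); apply: (implyP (m'_min m)).
by rewrite xm; apply/forallP => z; apply/implyP/m_min.
Qed.

Lemma pi_upE x m : ~~ contains_3142 m -> Theta_3412 x m -> pi_up_3412 x = m.
Proof.
rewrite contains_step_up => mn xm.
have m_max z : Theta_3412 x z -> weak_le z m.
  move=> xz; apply: (@swap_connect_weak true); apply: normal_Theta => //.
  by apply: connect_trans xm; rewrite -/(Theta_3412 _ _) Theta_sym.
rewrite /pi_up_3412; case: pickP => [m' /andP[xm' /forallP m'_max]|/(_ m)/negP[]].
  by apply: weak_le_anti (implyP (m'_max m) xm); apply: m_max.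
by rewrite xm; apply/forallP => z; apply/implyP/m_max.
Qed.

Lemma Theta_normal up x :
  exists2 m, ~~ [exists y, swap_step up m y] & Theta_3412 x m.
Proof.
have [m xm mn] := normal_form (@weight_step up) x.
exists m; first exact/existsPn.
rewrite (ThetaE up); apply: connect_sub xm => u v uv.
by apply: connect1; rewrite uv.
Qed.

Lemma pi_downP x :
  ~~ contains_3412 (pi_down_3412 x) /\ Theta_3412 x (pi_down_3412 x).
Proof.
have [m mn xm] := Theta_normal false x; rewrite -contains_step_down in mn.
by rewrite (pi_downE mn xm).
Qed.

Lemma pi_upP x :
  ~~ contains_3142 (pi_up_3412 x) /\ Theta_3412 x (pi_up_3412 x).
Proof.
have [m mn xm] := Theta_normal true x; rewrite -contains_step_up in mn.
by rewrite (pi_upE mn xm).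
Qed.

(** * Separated pairs and their invariance under moves *)

Definition before x u v : bool := (x^-1)%g u < (x^-1)%g v.

Lemma before_swap x q r u v : r = q.+1 :> nat ->
  ~ (u = x q /\ v = x r) -> ~ (u = x r /\ v = x q) ->
  before (tperm q r * x)%g u v = before x u v.
Proof.
move=> rq; rewrite -(permKV x u) -(permKV x v); move: (_ u) (_ v) => i j ne1 ne2.
rewrite /before !invMg tpermV !permM !permK.
have {}ne1 : ~ (i = q :> nat /\ j = r :> nat).
  by move=> [/val_inj Di /val_inj Dj]; apply: ne1; rewrite Di Dj.
have {}ne2 : ~ (i = r :> nat /\ j = q :> nat).
  by move=> [/val_inj Di /val_inj Dj]; apply: ne2; rewrite Di Dj.
case: tpermP ne1 ne2 => [->|->|/eqP/val_neq ? /eqP/val_neq ?];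
  case: tpermP => [->|->|/eqP/val_neq ? /eqP/val_neq ?]; by lia.
Qed.

(** A form of 2-41-3 in which [d] and [a] need not be adjacent: the entries standing between them
    have values outside the interval from [a] to [d]. *)
Definition separated x a d : Prop :=
  [/\ before x d a,
      forall v, a < v < d -> before x v d \/ before x a v,
      forall u v, a < u < d -> a < v < d -> before x u d -> before x a v -> u < v,
      exists2 u : 'I_n, a < u < d & before x u d
    & exists2 v : 'I_n, a < v < d & before x a v].

(** Only a swap of [d] with [a], or of one of them with a value in between, could do harm. The
    witnesses of such a move would have values between [a] and [d], the larger one left of [d] and
    the smaller one right of [a], against the separation. *)
Lemma separated_step up x y a d :
  swap_step up x y -> separated x a d -> separated y a d.
Proof.
move=> /swap_stepP[q [r [/swappableP[rq [p [s [pq rs bs sp cp]]]] _ ->]]].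
move=> [da out sep exl exr].
pose pos (u : 'I_n) : nat := (x^-1)%g u.
have posE i : pos (x i) = i by rewrite /pos permK.
have bad : a < x p < d -> a < x s < d -> pos (x p) < pos d -> pos a < pos (x s) ->
    False by move=> xp_in xs_in pd as_; have := sep _ _ xp_in xs_in pd as_; lia.
have {}out (v : 'I_n) : a < v < d -> pos v < pos d \/ pos a < pos v := out v.
have {}da : pos d < pos a := da.
have := out (x p); have := out (x s); rewrite posE (posE p) => outs outp.
have ad : a < d by have [u u_in _] := exl; lia.
have eq_da : before (tperm q r * x)%g d a = before x d a.
  apply: before_swap => // -[Ed Ea]; last by move: da; rewrite Ed Ea !posE; lia.
  by subst d a; rewrite !posE in outs outp da; apply: bad; rewrite ?posE; lia.
have eq_vd (v : 'I_n) : a < v < d -> before (tperm q r * x)%g v d = before x v d.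
  move=> v_in; have := out v v_in => outv.
  apply: before_swap => // -[Ev Ed]; last first.
    by move: da outv; rewrite Ed Ev !posE; lia.
  by subst d v; rewrite !posE in outs outp outv da; apply: bad; rewrite ?posE; lia.
have eq_av (v : 'I_n) : a < v < d -> before (tperm q r * x)%g a v = before x a v.
  move=> v_in; have := out v v_in => outv.
  apply: before_swap => // -[Ea Ev]; last first.
    by move: da outv; rewrite Ea Ev !posE; lia.
  by subst a v; rewrite !posE in outs outp outv da; apply: bad; rewrite ?posE; lia.
split=> //.
- by rewrite eq_da.
- by move=> v v_in; rewrite eq_vd ?eq_av //; apply: out.
- by move=> u v u_in v_in; rewrite eq_vd ?eq_av //; apply: sep.
- by have [u u_in ud] := exl; exists u; rewrite ?eq_vd.
- by have [v v_in av] := exr; exists v; rewrite ?eq_av.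
Qed.

Lemma separated_Theta x y a d : Theta_3412 x y -> separated x a d -> separated y a d.
Proof.
rewrite (ThetaE true) => /connectP[p + ->]; elim: p x => //= z p IH x.
move=> /andP[xz zp] sx; apply: (IH z) => //.
by case/orP: xz => [|]; last rewrite swap_step_sym; move=> xz; apply: separated_step xz sx.
Qed.

(** * Separated pairs and the pattern 2-41-3 *)

(** From [d] to [a] every entry is at least [d] or at most [a], so some adjacent pair drops across
    the whole interval; [u] and [v] complete the pattern. *)
Lemma separated_contains_2413 x a d : separated x a d -> contains_2413 x.
Proof.
move=> [da out sep [u u_in ud] [v v_in av]].
have uv : u < v by apply: sep.
have Pd : d <= x ((x^-1)%g d) by rewrite permKV.
have Pa : ~~ (d <= x ((x^-1)%g a)) by rewrite permKV; lia.
have [q [r [rq dq ra Pq Pr]]] := last_in_prefix (P := fun i => d <= x i) da Pd Pa.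
have xr_a : x r <= a.
  by have := out (x r); rewrite /before permK; lia.
apply/existsP; exists ((x^-1)%g u); apply/existsP; exists q.
apply/existsP; exists r; apply/existsP; exists ((x^-1)%g v).
rewrite /occ_2413 /vincular_pos !permKV.
by rewrite /before in ud av da; lia.
Qed.

(** The adjacent middle entries of a 2-41-3 form the pair: a larger value on the left with a smaller
    one on the right would give 3-41-2. *)
Lemma separated_of_avoid_3412 x :
  ~~ contains_3412 x -> contains_2413 x -> exists a d, separated x a d.
Proof.
move=> avoid /existsP[p /existsP[q /existsP[r /existsP[s]]]].
move=> /andP[/and3P[pq /eqP rq rs] /and3P[ab bc cd]].
exists (x r), (x q); rewrite /separated /before !permK.
have val_pos i v : v != x i -> ((x^-1)%g v : nat) <> i.
  by move=> vi /val_inj iE; rewrite -iE permKV eqxx in vi.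
split; first by lia.
- move=> v v_in; have : ((x^-1)%g v : nat) <> q.
    by apply: val_pos; rewrite -val_eqE /=; lia.
  have : ((x^-1)%g v : nat) <> r by apply: val_pos; rewrite -val_eqE /=; lia.
  by lia.
- move=> u v u_in v_in uq rv; rewrite ltnNge; apply: contra avoid => vu.
  have vu' : (v : nat) <> u.
    by move=> /val_inj E; move: uq rv; rewrite E; lia.
  apply/existsP; exists ((x^-1)%g u); apply/existsP; exists q.
  apply/existsP; exists r; apply/existsP; exists ((x^-1)%g v).
  by rewrite /occ_3412 /vincular_pos !permKV; lia.
- by exists (x p); rewrite ?permK; lia.
- by exists (x s); rewrite ?permK; lia.
Qed.

(** Otherwise some adjacent ascent between [i] and [j] jumps over both [b] and [c], which stand
    outside this range, and makes a 3-14-2 with them. *)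
Lemma big_before_small x b c i j : ~~ contains_3142 x -> c = b.+1 :> nat ->
  (x^-1)%g c < i -> i < j -> j < (x^-1)%g b -> x i < b -> x j <= c.
Proof.
move=> avoid cb ci ij jb xi; rewrite leqNgt; apply: contra avoid => xj.
have Pi : x i < c by lia.
have Pj : ~~ (x j < c) by lia.
have [q [r [rq iq rj Pq Pr]]] := last_in_prefix (P := fun i => x i < c) ij Pi Pj.
have xq : (x q : nat) <> b.
  by move=> /val_inj E; move: jb; rewrite -E permK; lia.
have xr : (x r : nat) <> c.
  by move=> /val_inj E; move: ci; rewrite -E permK; lia.
apply/existsP; exists ((x^-1)%g c); apply/existsP; exists q.
apply/existsP; exists r; apply/existsP; exists ((x^-1)%g b).
by rewrite /occ_3142 /vincular_pos !permKV; lia.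
Qed.

(* If some larger value on the left of [d ... a] exceeds a smaller one on the
   right, there are two consecutive such values w < w'; since 3-14-2 is avoided,
   one of the pairs (a, w'), (w, d) spans a shorter configuration. *)
Lemma separated_of_spread_2413 x a d u v :
  ~~ contains_3142 x -> before x d a ->
  (forall w, a < w < d -> before x w d \/ before x a w) ->
  a < u -> u < v -> v < d -> before x u d -> before x a v ->
  exists a' d', separated x a' d'.
Proof.
move=> avoid; have [k] := ubnP (d - a); elim: k => // k IH in a d u v * => dk.
move=> da out au uv vd ud av.
have [/existsP[c /existsP[b /and5P[c_in b_in cd ab bc]]]|no_inv] :=
  boolP [exists c : 'I_n, exists b : 'I_n,
    [&& a < c < d, a < b < d, before x c d, before x a b & b <= c]]; last first.
  exists a, d; split=> //.
  - move=> c b c_in b_in cd ab; rewrite ltnNge; apply: contra no_inv => bc.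
    by apply/existsP; exists c; apply/existsP; exists b; rewrite c_in b_in cd ab.
  - by exists u => //; lia.
  - by exists v => //; lia.
have lt_bc : b < c.
  have : (b : nat) <> c.
    by move=> /val_inj E; move: cd ab da; rewrite E /before; lia.
  by lia.
have Pc : ~~ before x a c by move: cd da; rewrite /before; lia.
(* Here the search runs over values: [w] stands right of [a], and its successor [w'] left of [d]. *)
have [w [w' [w'w bw w'c aw naw']]] := last_in_prefix (P := before x a) lt_bc ab Pc.
have w'd : before x w' d by have := out w'; rewrite (negPf naw'); case=> //; lia.
pose pos (t : 'I_n) : nat := (x^-1)%g t.
have order (s t : 'I_n) : pos w' < pos s -> pos s < pos t -> pos t < pos w ->
    s < w -> t <= w'.
  move=> ws st tw sw; rewrite -(permKV x t).
  by apply: big_before_small w'w ws st tw _ => //; rewrite permKV.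
have inj_pos (s t : 'I_n) : (s : nat) <> t -> pos s <> pos t.
  by move=> st /val_inj/perm_inj E; apply: st; rewrite E.
have eq_pos (s t : 'I_n) : (s : nat) = t -> pos s = pos t by move=> /val_inj ->.
rewrite /before -!/(pos _) in da ud av aw w'd.
have {}out (t : 'I_n) : a < t < d -> pos t < pos d \/ pos a < pos t := out t.
(* If [u] is below [w], the pair [a], [w'] works, with [u] on its left and [w] on its right;
   otherwise the pair [w], [d] works, with [w'] and [v]. In both cases [order] keeps values of the
   new interval from standing between the new ends. *)
have [uw|wu] := ltnP u w.
  have uw' : pos u < pos w'.
    by have := inj_pos u w'; have := order u d; lia.
  apply: (IH a w' u w) => //; rewrite /before -!/(pos _); try lia.
  move=> t t_in; rewrite -!/(pos _); have := out t; have := inj_pos t w'.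
  by have := eq_pos t w; have := order t d; lia.
have wv : w' < v.
  by have := eq_pos u w; lia.
have wv_pos : pos w < pos v.
  by have := inj_pos w v; have := order a v; lia.
apply: (IH w d w' v) => //; rewrite /before -!/(pos _); try lia.
move=> t t_in; rewrite -!/(pos _); have := out t; have := inj_pos t w.
by have := eq_pos t w'; have := order a t; lia.
Qed.

Lemma separated_of_avoid_3142 x :
  ~~ contains_3142 x -> contains_2413 x -> exists a d, separated x a d.
Proof.
move=> avoid /existsP[p /existsP[q /existsP[r /existsP[s]]]].
move=> /andP[/and3P[pq /eqP rq rs] /and3P[ab bc cd]].
have val_pos i v : v != x i -> ((x^-1)%g v : nat) <> i.
  by move=> vi /val_inj iE; rewrite -iE permKV eqxx in vi.
apply: (@separated_of_spread_2413 x (x r) (x q) (x p) (x s));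
  rewrite /before ?permK //; try lia.
move=> w w_in.
have : ((x^-1)%g w : nat) <> q by apply: val_pos; rewrite -val_eqE /=; lia.
have : ((x^-1)%g w : nat) <> r by apply: val_pos; rewrite -val_eqE /=; lia.
by lia.
Qed.

(** The avoidance at [m] turns 2-41-3 into a separated pair, which the moves carry to [x]. *)
Lemma contains_2413_Theta x m : ~~ contains_3412 m \/ ~~ contains_3142 m ->
  Theta_3412 m x -> contains_2413 m -> contains_2413 x.
Proof.
move=> avoid mx m2413.
have [a [d sep]] : exists a d, separated m a d.
  case: avoid => avoid; first exact: separated_of_avoid_3412.
  exact: separated_of_avoid_3142.
by apply: (@separated_contains_2413 x a d); apply: separated_Theta mx sep.
Qed.

(** * The bijection *)

Lemma pi_down_twisted x : x \in Baxter n -> pi_down_3412 x \in twisted_Baxter n.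
Proof.
rewrite !inE => /andP[_ x2413]; have [avoid xm] := pi_downP x.
rewrite avoid; apply: contra x2413; apply: contains_2413_Theta; first by left.
by rewrite Theta_sym.
Qed.

Lemma pi_up_Baxter x : x \in twisted_Baxter n -> pi_up_3412 x \in Baxter n.
Proof.
rewrite !inE => /andP[_ x2413]; have [avoid xm] := pi_upP x.
rewrite avoid; apply: contra x2413; apply: contains_2413_Theta; first by right.
by rewrite Theta_sym.
Qed.

Lemma pi_downK : {in Baxter n, cancel (@pi_down_3412 n) (@pi_up_3412 n)}.
Proof.
move=> x; rewrite inE => /andP[avoid _]; apply: pi_upE => //.
by rewrite Theta_sym; case: (pi_downP x).
Qed.

Lemma pi_upK : {in twisted_Baxter n, cancel (@pi_up_3412 n) (@pi_down_3412 n)}.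
Proof.
move=> x; rewrite inE => /andP[avoid _]; apply: pi_downE => //.
by rewrite Theta_sym; case: (pi_upP x).
Qed.

End Moves.

Theorem theorem8p2 (n : nat) (n_gt0 : 0 < n) :
  [/\ {in Baxter n &, injective (@pi_down_3412 n)},
      [set pi_down_3412 x | x in Baxter n] = twisted_Baxter n,
      {in twisted_Baxter n, forall y, pi_up_3412 y \in Baxter n},
      {in Baxter n, cancel (@pi_down_3412 n) (@pi_up_3412 n)} &
      {in twisted_Baxter n, cancel (@pi_up_3412 n) (@pi_down_3412 n)}].
Proof.
split; [exact: can_in_inj (@pi_downK n) | | exact: pi_up_Baxter
       | exact: pi_downK | exact: pi_upK].
apply/setP => y; apply/imsetP/idP => [[x Bx ->]|ty].
  exact: pi_down_twisted.
by exists (pi_up_3412 y); rewrite ?pi_up_Baxter ?pi_upK.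
Qed.
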